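(* Let $(X,d)$ be a geodesic space and let $\Phi:X\to\mathbb R\cup\{+\infty\}$ be a proper geodesically convex functional bounded from below. Let $p,q\in(1,+\infty)$ satisfy $p^{-1}+q^{-1}=1$. Let $u\in X$ and $\varepsilon>0$ be such that $$\Phi(u)\le \inf_{v\in X}\Phi(v)+\varepsilon.$$ Then, for any $\lambda>0$ and any $\hat u\in \operatorname{prox}_{\frac{\lambda^p}{\varepsilon}\Phi}(u)$, the following estimates hold: (a) $d(u,\hat u)\le \lambda$; (b) $\Phi(\hat u)\le \Phi(u)$; (c) $\Phi(\hat u)\le \Phi(v)+\dfrac{\varepsilon}{\lambda}\,d(v,\hat u)$ for all $v\in X$.
   Context: A geodesic space is a metric space $(X,d)$ such that for every $u,v\in X$ there is a constant-speed geodesic $\gamma:[0,1]\to X$ with $\gamma(0)=u$ and $\gamma(1)=v$, where constant-speed geodesic means $d(\gamma(s),\gamma(t))=|s-t|\,d(\gamma(0),\gamma(1))$ for all $s,t\in[0,1]$. Completeness is not assumed. A functional $\Phi:X\to\mathbb R\cup\{+\infty\}$ is proper if it is not identically $+\infty$. It is geodesically convex if for every $u,v\in X$ there is at least one constant-speed geodesic $\gamma:[0,1]\to X$ with $\gamma(0)=u$, $\gamma(1)=v$ and $\Phi(\gamma(t))\le(1-t)\Phi(\gamma(0))+t\Phi(\gamma(1))$ for all $t\in[0,1]$. Lower semicontinuity is not assumed. For a functional $\Psi:X\to\mathbb R\cup\{+\infty\}$, the (set-valued, possibly empty) proximal mapping with exponent $p$ is $$\operatorname{prox}_{\Psi}(u):=\operatorname*{arg\,min}_{v\in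 X}\Big\{\Psi(v)+\frac1p\,d(v,u)^p\Big\}.$$ *)

(* Defs.v *)
From HB Require Import structures.
From mathcomp Require Import all_boot all_order all_algebra.
From mathcomp Require Import all_classical all_reals all_analysis.

Set Implicit Arguments.
Unset Strict Implicit.
Unset Printing Implicit Defensive.

Import Order.TTheory GRing.Theory Num.Theory.

Local Open Scope classical_set_scope.
Local Open Scope ring_scope.

(* Curves [0,1] -> X are represented by total functions R -> X whose values
   outside [0,1] are irrelevant. *)
Definition constant_speed_geodesic (R : realType) (X : metricType R)
    (gamma : R -> X) : Prop :=
  forall s t : R, 0 <= s <= 1 -> 0 <= t <= 1 ->
    mdist (gamma s) (gamma t) = `|s - t| * mdist (gamma 0) (gamma 1).

Definition geodesic_space (R : realType) (X : metricType R) : Prop :=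
  forall u v : X, exists gamma : R -> X,
    [/\ constant_speed_geodesic gamma, gamma 0 = u & gamma 1 = v].

(* Functionals X -> R U {+oo} are functions X -> \bar R that never take the
   value -oo. *)
Definition ninfty_free (R : realType) (X : Type) (Phi : X -> \bar R) : Prop :=
  forall x : X, Phi x <> -oo%E.

Definition proper_functional (R : realType) (X : Type)
    (Phi : X -> \bar R) : Prop :=
  exists x : X, Phi x <> +oo%E.

Definition bounded_from_below (R : realType) (X : Type)
    (Phi : X -> \bar R) : Prop :=
  exists m : R, forall x : X, (m%:E <= Phi x)%E.

(* In \bar R, 0 * +oo = 0, so the inequality is trivially satisfied at the
   endpoints t = 0 and t = 1. *)
Definition geodesically_convex (R : realType) (X : metricType R)
    (Phi : X -> \bar R) : Prop :=
  forall u v : X, exists gamma : R -> X,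
    [/\ constant_speed_geodesic gamma, gamma 0 = u, gamma 1 = v &
        forall t : R, 0 <= t <= 1 ->
          (Phi (gamma t) <=
             (1 - t)%:E * Phi (gamma 0%R) + t%:E * Phi (gamma 1%R))%E].

Definition argmin (R : realType) (X : Type) (f : X -> \bar R) : set X :=
  [set v | forall w : X, (f v <= f w)%E].

Definition prox (R : realType) (X : metricType R) (p : R)
    (Psi : X -> \bar R) (u : X) : set X :=
  argmin (fun v : X => (Psi v + (p^-1 * mdist v u `^ p)%:E)%E).

(* Main.v *)
(** Move from the proximal point [uhat] along a geodesic on which [Phi] is
    convex.  Minimality of [uhat] bounds the decrease of [c * Phi], where
    [c = lambda^p / eps], by the increase of [d(., u)^p / p], and the tangent
    line inequality for [x^p] turns this into a first order bound.  The
    geodesic to [u], stopped at distance [lambda] from [u], contradicts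
    [d(uhat, u) > lambda]; the geodesic to [v] with vanishing time gives (c),
    where by (a) the slope is at most [lambda^(p-1)]. *)

Require Import Defs.
From HB Require Import structures.
From mathcomp Require Import all_boot all_order all_algebra.
From mathcomp Require Import all_classical all_reals all_analysis.
From mathcomp Require Import ring lra.

Set Implicit Arguments.
Unset Strict Implicit.
Unset Printing Implicit Defensive.

Import Order.TTheory GRing.Theory Num.Theory.

Local Open Scope classical_set_scope.
Local Open Scope ring_scope.

Lemma powR_tangent_le (R : realType) (p q x y : R) :
  1 < p -> 1 < q -> p^-1 + q^-1 = 1 -> 0 <= x -> 0 <= y ->
  y `^ p + p * y `^ (p - 1) * (x - y) <= x `^ p.
Proof.
move=> p1 q1 pq x0 y0.
have p0 : 0 < p by lra.
have q0 : 0 < q by lra.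
(* Young's inequality for [x] and [y^(p-1)], since [(p-1) q = p]. *)
have := conjugate_powR x0 (powR_ge0 y (p - 1)) p0 q0 pq.
rewrite -powRrM.
have -> : (p - 1) * q = p.
  have : (p^-1 + q^-1) * (p * q) = p * q by rewrite pq mul1r.
  have -> : (p^-1 + q^-1) * (p * q) = p + q by field; rewrite !gt_eqF.
  lra.
have -> : q^-1 = 1 - p^-1 by rewrite -pq; ring.
rewrite -(ler_pM2l p0) => young.
have {}young : p * (x * y `^ (p - 1)) <= x `^ p + (p - 1) * y `^ p.
  by apply: le_trans young _; rewrite le_eqVlt; apply/orP; left; apply/eqP;
    field; rewrite gt_eqF.
have := mulr_powRB1 y0 p0; nra.
Qed.

(** Stands in for right continuity of the power at [x]: it lets the geodesic time tend to 0 without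
    any limit being taken. *)
Lemma powR_ge_right_limit (R : realType) (r x d K : R) :
  0 < r -> 0 <= x -> 0 < d ->
  (forall y, x < y -> y <= x + d -> K <= y `^ r) -> K <= x `^ r.
Proof.
move=> r0 x0 d0 leK; rewrite leNgt; apply/negP => xK.
have K0 : 0 <= K by apply: le_trans (ltW xK); exact: powR_ge0.
pose z := K `^ r^-1.
have z0 : 0 <= z := powR_ge0 _ _.
have zr : z `^ r = K by rewrite -powRrM mulVf ?gt_eqF// powRr1.
have xz : x < z.
  rewrite ltNge; apply/negP => zx; move: xK; apply/negP; rewrite -leNgt -zr.
  by apply: ge0_ler_powR; rewrite ?nnegrE// ltW.
(* A point strictly between [x] and the root [z] of [K], capped at [x + d] so that [leK] applies to
   it. *)
pose y := Num.min ((x + z) / 2) (x + d).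
have xy : x < y by rewrite lt_min; apply/andP; split; lra.
have yz : y < z by rewrite gt_min; apply/orP; left; lra.
have yd : y <= x + d by rewrite ge_min lexx orbT.
have := leK y xy yd; apply/negP; rewrite -ltNge -zr.
by apply: gt0_ltr_powR; rewrite ?nnegrE//; lra.
Qed.

Lemma prox_le_along_geodesic (R : realType) (X : metricType R)
    (Phi : X -> \bar R) (p c a b : R) (u uhat v : X) :
  geodesically_convex Phi -> 0 <= c ->
  prox p (fun w : X => (c%:E * Phi w)%E) u uhat ->
  Phi uhat = a%:E -> Phi v = b%:E ->
  exists gamma : R -> X,
    [/\ constant_speed_geodesic gamma, gamma 0 = uhat, gamma 1 = v &
        forall t : R, 0 <= t <= 1 ->
          c * t * (a - b) <=
          p^-1 * (mdist (gamma t) u `^ p - mdist uhat u `^ p)].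
Proof.
move=> cvx c0 prox_uhat Pa Pb; have [gamma [geo g0 g1 cvxg]] := cvx uhat v.
exists gamma; split=> // t t01.
have min_t := prox_uhat (gamma t).
have := cvxg t t01; rewrite g0 g1 Pa Pb -!EFinM -EFinD => cvx_t.
have := le_trans min_t (leeD2r _ (lee_wpmul2l (c0 : (0 <= c%:E)%E) cvx_t)).
rewrite Pa -!EFinM -!EFinD lee_fin; nra.
Qed.

Lemma bounded_from_below_fin_num (R : realType) (X : Type) (Phi : X -> \bar R)
    (x : X) : bounded_from_below Phi -> (Phi x < +oo)%E -> Phi x \is a fin_num.
Proof.
by move=> [m mP] Px; rewrite fin_real// Px andbT (lt_le_trans (ltNyr m)).
Qed.

(** The competitor [u] has zero distance term. Since [c > 0], an infinite [Phi uhat] would make the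
    minimum infinite, so [Phi uhat] is real. *)
Lemma prox_le (R : realType) (X : metricType R) (Phi : X -> \bar R)
    (p c b : R) (u uhat : X) :
  0 < p -> 0 < c -> bounded_from_below Phi ->
  prox p (fun w : X => (c%:E * Phi w)%E) u uhat -> Phi u = b%:E ->
  exists2 a : R, Phi uhat = a%:E & a <= b.
Proof.
move=> p0 c0 bnd prox_uhat Pb; have := prox_uhat u.
rewrite mdistxx powR0 ?gt_eqF// mulr0 adde0 Pb -EFinM => min_u.
have D0 : 0 <= p^-1 * mdist uhat u `^ p by rewrite mulr_ge0 ?powR_ge0// invr_ge0 ltW.
have cP : (c%:E * Phi uhat <= (c * b)%:E)%E.
  by apply: le_trans min_u; rewrite leeDl.
have Poo : (Phi uhat < +oo)%E.
  by rewrite ltey; apply/eqP => Poo; move: cP; rewrite Poo gt0_muley ?lte_fin.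
have /fineK fP := bounded_from_below_fin_num bnd Poo.
exists (fine (Phi uhat)) => //.
by move: cP; rewrite -fP -EFinM lee_fin ler_pM2l.
Qed.

Lemma prox_dist_le (R : realType) (X : metricType R) (Phi : X -> \bar R)
    (p q c lambda a b : R) (u uhat : X) :
  1 < p -> 1 < q -> p^-1 + q^-1 = 1 -> 0 < c -> 0 < lambda ->
  geodesically_convex Phi ->
  prox p (fun w : X => (c%:E * Phi w)%E) u uhat ->
  Phi uhat = a%:E -> Phi u = b%:E -> c * (b - a) <= lambda `^ p ->
  mdist uhat u <= lambda.
Proof.
move=> p1 q1 pq c0 l0 cvx prox_uhat Pa Pb cab.
have [gamma [geo g0 g1 slope]] :=
  prox_le_along_geodesic cvx (ltW c0) prox_uhat Pa Pb.
rewrite leNgt; apply/negP => lD; set D := mdist uhat u in lD slope.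
have p0 : 0 < p by lra.
have D0 : 0 < D by lra.
(* The time at which the geodesic from [uhat] to [u] is at distance [(1 - t) * D = lambda] from
   [u]. *)
pose t := 1 - lambda / D.
have tD : t * D = D - lambda by rewrite /t mulrBl divfK ?mul1r// gt_eqF.
have t0 : 0 < t by rewrite -(pmulr_lgt0 _ D0) tD; lra.
have t1 : t < 1 by rewrite /t ltrBlDr ltrDl divr_gt0.
have t01 : 0 <= t <= 1 by rewrite !ltW.
have dist_t : mdist (gamma t) u = lambda.
  rewrite -[in LHS]g1 geo ?g0 ?g1 ?lexx ?ler01//.
  rewrite ltr0_norm ?subr_lt0// -/D mulNr mulrBl tD; lra.
have := slope t t01; rewrite dist_t.
have := powR_tangent_le p1 q1 pq (ltW D0) (ltW l0).
rewrite -(ler_pM2l (_ : 0 < p^-1)) ?invr_gt0// => tangent.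
have {tangent} : lambda `^ (p - 1) * (t * D) <=
    p^-1 * (D `^ p - lambda `^ p).
  rewrite tD -subr_ge0; move: tangent; rewrite -subr_ge0; congr (0 <= _).
  by field; rewrite gt_eqF.
(* The slope and tangent bounds, divided by [t], give [lambda^(p-1) * D <= c * (b - a) <= lambda^p],
   which this contradicts. *)
have : lambda `^ p < lambda `^ (p - 1) * D.
  by rewrite -mulr_powRB1 ?(ltW l0)// mulrC ltr_pM2l ?powR_gt0.
nra.
Qed.

Lemma prox_slope_le (R : realType) (X : metricType R) (Phi : X -> \bar R)
    (p q c lambda a b : R) (u uhat v : X) :
  1 < p -> 1 < q -> p^-1 + q^-1 = 1 -> 0 < c ->
  geodesically_convex Phi ->
  prox p (fun w : X => (c%:E * Phi w)%E) u uhat ->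
  Phi uhat = a%:E -> Phi v = b%:E -> mdist uhat u <= lambda ->
  c * (a - b) <= lambda `^ (p - 1) * mdist uhat v.
Proof.
move=> p1 q1 pq c0 cvx prox_uhat Pa Pb; set D := mdist uhat u => Dl.
have p0 : 0 < p by lra.
have D0 : 0 <= D := mdist_ge0 _ _.
have [uv|uv] := eqVneq uhat v.
  have -> : a = b by apply: EFin_inj; rewrite -Pa -Pb uv.
  by rewrite subrr mulr0 mulr_ge0 ?powR_ge0 ?mdist_ge0.
have [gamma [geo g0 g1 slope]] :=
  prox_le_along_geodesic cvx (ltW c0) prox_uhat Pa Pb.
have L0 : 0 < mdist uhat v by rewrite mdist_gt0.
set L := mdist uhat v in L0 *.
rewrite -ler_pdivrMr//.
(* Each [y] in [(lambda, lambda + L]] is written as [lambda + t * L] with [0 < t <= 1]. It dominates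
   [D + t * L], the triangle bound on the distance from [gamma t] to [u]. *)
apply: (@powR_ge_right_limit _ _ _ L) => //; [lra|lra|] => y ly yL.
pose t := (y - lambda) / L.
have tL : t * L = y - lambda by rewrite divfK// gt_eqF.
have t0 : 0 < t by rewrite divr_gt0// subr_gt0.
have t1 : t <= 1 by rewrite ler_pdivrMr// mul1r; lra.
have t01 : 0 <= t <= 1 by rewrite ltW.
have dist_t : mdist (gamma t) u <= D + t * L.
  rewrite (le_trans (metric_triangle _ uhat _))// addrC lerD2l.
  by rewrite -g0 geo ?g0 ?g1 ?lexx ?ler01// subr0 gtr0_norm.
have z0 : 0 <= D + t * L by lra.
have dist_tp : mdist (gamma t) u `^ p <= (D + t * L) `^ p.
  by apply: ge0_ler_powR; rewrite ?nnegrE ?mdist_ge0// ltW.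
have slope_t := slope t t01.
(* The tangent is taken at the far end [D + t * L], so that it bounds the increase of the power from
   above. *)
have tangent := powR_tangent_le p1 q1 pq D0 z0.
have zy : (D + t * L) `^ (p - 1) <= y `^ (p - 1).
  by apply: ge0_ler_powR; rewrite ?nnegrE; lra.
rewrite ler_pdivrMr// -(ler_pM2l t0) mulrCA mulrA.
apply: le_trans slope_t _; rewrite ler_pdivrMl//.
have : (D + t * L) `^ (p - 1) * (p * (t * L)) <= y `^ (p - 1) * (p * (t * L)).
  by rewrite ler_wpM2r// ltW// !(mulr_gt0 p0, mulr_gt0 t0 L0).
rewrite -/D; lra.
Qed.

Theorem theorem1p1 (R : realType) (X : metricType R)
    (hX : geodesic_space X)
    (Phi : X -> \bar R)
    (hPhi_ninfty : ninfty_free Phi)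
    (hPhi_proper : proper_functional Phi)
    (hPhi_convex : geodesically_convex Phi)
    (hPhi_bounded : bounded_from_below Phi)
    (p q : R) (hp : 1 < p) (hq : 1 < q) (hpq : p^-1 + q^-1 = 1)
    (u : X) (eps : R) (heps : 0 < eps)
    (hu : (Phi u <= ereal_inf [set Phi v | v in [set: X]] + eps%:E)%E)
    (lambda : R) (hlambda : 0 < lambda)
    (uhat : X)
    (huhat : prox p (fun v : X => ((lambda `^ p / eps)%:E * Phi v)%E) u uhat) :
  [/\ mdist u uhat <= lambda,
      (Phi uhat <= Phi u)%E &
      forall v : X, (Phi uhat <= Phi v + (eps / lambda * mdist v uhat)%:E)%E].
Proof.
have c0 : 0 < lambda `^ p / eps by rewrite divr_gt0// powR_gt0.
have p0 : 0 < p by lra.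
have Pu_le x : (Phi u <= Phi x + eps%:E)%E.
  by apply: le_trans hu _; rewrite leeD2r//; apply: ereal_inf_lbound; exists x.
have Puoo : (Phi u < +oo)%E.
  have [x /eqP Px] := hPhi_proper.
  by rewrite (le_lt_trans (Pu_le x))// lte_add_pinfty ?ltry// ltey.
have Pu := esym (fineK (bounded_from_below_fin_num hPhi_bounded Puoo)).
have [a Pa ab] := prox_le p0 c0 hPhi_bounded huhat Pu.
have Pu_eps : fine (Phi u) - a <= eps.
  rewrite lerBlDl -lee_fin EFinD -Pu -Pa; exact: Pu_le.
have D_le : mdist uhat u <= lambda.
  apply: (prox_dist_le hp hq hpq c0 hlambda hPhi_convex huhat Pa Pu).
  (* The factor [c = lambda^p / eps] turns the gap [eps] into exactly [lambda^p]. *)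
  by rewrite mulrAC ler_pdivrMr// ler_pM2l ?powR_gt0.
split; [by rewrite metric_sym | by rewrite Pa Pu lee_fin |] => v.
have [->|Pvoo] := eqVneq (Phi v) +oo%E; first by rewrite addye ?leey.
have [b Pv] : exists b, Phi v = b%:E.
  exists (fine (Phi v)); rewrite fineK// bounded_from_below_fin_num//.
  by rewrite ltey.
have slope := prox_slope_le hp hq hpq c0 hPhi_convex huhat Pa Pv D_le.
rewrite Pa Pv -EFinD lee_fin metric_sym -lerBlDl -(ler_pM2l c0).
(* Both sides agree, because [c * (eps / lambda) = lambda^p / lambda = lambda^(p-1)]. *)
rewrite (le_trans slope)// -(mulr_powRB1 (ltW hlambda) p0).
by rewrite le_eqVlt; apply/orP; left; apply/eqP; field; rewrite !gt_eqF.
Qed.
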